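(* Every operator equation constructed by three functions operators of two variables can be given a formula solution represented as a superposition of three functions operators of one variable. That is, let $A=\{-e,o,e\}$, and let $t_1(y,h_1,\dots,h_n)=t_2(y,h_1,\dots,h_n)$ be an equation with unknown $y$ and parameters $h_1,\dots,h_n$ ($n\ge1$) ranging over $A$, where $t_1,t_2$ are terms built from the variables $y,h_1,\dots,h_n$ by finitely many applications of three functions operators of two variables. Then its solution operator $W:A^n\to\mathcal{P}(A)$, which assigns to $(h_1,\dots,h_n)$ the set of all $y\in A$ satisfying the equation, is a superposition, in the variables $h_1,\dots,h_n$, of three functions operators of one variable.
   Context: On $\{-1,0,1\}$ with addition modulo $3$, consider the three functions $-e=(1,0,-1)$, $o=(0,0,0)$, $e=(-1,0,1)$, each triple listing the values at $-1,0,1$ in this order. Let $A=\{-e,o,e\}$ with pointwise addition modulo $3$ (so $o$ is the zero element, $e+e=-e$, $(-e)+(-e)=e$, $e+(-e)=o$). A three functions operator of $M$ variables assigns to each point of $A^M$ a set of values in $A$ (one value, several values, or no value), i.e. it is a map $A^M\to\mathcal{P}(A)$, where $\mathcal{P}(A)$ is the power set; single-valued operators are identified with ordinary maps $A^M\to A$. Conventions for combining values: for $S,T\subseteq A$, $S+T=\{s+t:s\in S,\ t\in T\}$ (empty if either set is empty). For an operator $\zeta$ of one variable, $\zeta[S]=\bigcup_{s\in S}\zeta(s)$. For an operator $\phi$ of two variables, $\phi(S,T)=\bigcup_{s\in S,\,t\in T}\phi(s,t)$. Sums and compositions of operators are pointwise with these conventions. Terms: each variable is a term, and if $t,t'$ are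 terms and $\phi$ is a three functions operator of two variables then $\phi(t,t')$ is a term. The equation $t_1=t_2$ is satisfied at given values of the variables if the value sets of $t_1$ and $t_2$ there have a common element (for single-valued operators this is ordinary equality; if $t_2$ is a parameter $h$, it means that $h$ is one of the values of $t_1$). A typical equation is $\phi_3\big(\phi_1(y,f),\phi_2(y,g)\big)=h$ with unknown $y$ and parameters $f,g,h$. The solution operator may be single-valued, many-valued or no-valued at a given point. Superpositions of operators of one variable, in variables $h_1,\dots,h_n$, are the operators $A^n\to\mathcal{P}(A)$ obtained by finitely many applications of the following rules: (i) $(h_1,\dots,h_n)\mapsto \eta(h_j)$ is a superposition for every operator $\eta:A\to\mathcal{P}(A)$ of one variable and every $j$; (ii) if $F,G$ are superpositions, so is $F+G$; (iii) if $F$ is a superposition and $\zeta:A\to\mathcal{P}(A)$ is an operator of one variable, then $\zeta[F]$ is a superposition. *)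

(* Defs.v *)
From HB Require Import structures.
From mathcomp Require Import all_boot all_order all_algebra.

Set Implicit Arguments.
Unset Strict Implicit.
Unset Printing Implicit Defensive.

Import GRing.Theory.
Local Open Scope ring_scope.

(* The set {-1, 0, 1} with addition modulo 3 is 'Z_3, and functions on it     *)
(* carry the pointwise addition of {ffun 'Z_3 -> 'Z_3}.                       *)
Definition fun_e : {ffun 'Z_3 -> 'Z_3} := [ffun x => x].
Definition fun_o : {ffun 'Z_3 -> 'Z_3} := [ffun=> 0].
Definition fun_me : {ffun 'Z_3 -> 'Z_3} := [ffun x => - x].

Lemma fun_e_values : [/\ fun_e (-1) = -1, fun_e 0 = 0 & fun_e 1 = 1].
Proof. by rewrite !ffunE. Qed.

Lemma fun_o_values : [/\ fun_o (-1) = 0, fun_o 0 = 0 & fun_o 1 = 0].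
Proof. by rewrite !ffunE. Qed.

Lemma fun_me_values : [/\ fun_me (-1) = 1, fun_me 0 = 0 & fun_me 1 = -1].
Proof. by rewrite !ffunE; split; apply/val_inj. Qed.

Definition three_functions : {pred {ffun 'Z_3 -> 'Z_3}} :=
  [pred f | f \in [:: fun_me; fun_o; fun_e]].

Fact three_functions_zmod_closed : zmod_closed three_functions.
Proof.
have oE : fun_o = 0 by apply/ffunP => x; rewrite !ffunE.
have meE : fun_me = - fun_e by apply/ffunP => x; rewrite !ffunE.
have eDe : fun_e + fun_e = - fun_e.
  by apply/ffunP => x; rewrite !ffunE; apply/val_inj; case: x => [[|[|[|[]]]]].
have NeDe : - fun_e - fun_e = fun_e by rewrite -opprD eDe opprK.
split=> [|f g]; rewrite !inE ?meE ?oE ?eqxx ?orbT //.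
by case/or3P=> /eqP-> /or3P[] /eqP->;
  rewrite ?opprK ?subr0 ?add0r ?subrr ?addNr ?eDe ?NeDe ?eqxx ?orbT.
Qed.

HB.instance Definition _ := GRing.isZmodClosed.Build
  {ffun 'Z_3 -> 'Z_3} three_functions three_functions_zmod_closed.

Record A := ThreeFun { tf_val :> {ffun 'Z_3 -> 'Z_3};
                       tf_valP : tf_val \in three_functions }.

HB.instance Definition _ := [isSub for tf_val].
HB.instance Definition _ := [Finite of A by <:].
HB.instance Definition _ := [SubChoice_isSubZmodule of A by <:].

(* Operators are set-valued: an empty set of values means "no value".         *)
(* Finite functions are used for M variables so that operators with the same  *)
(* values are equal.                                                          *)
Definition operator1 := A -> {set A}.
Definition operator2 := A -> A -> {set A}.
Definition operator (M : nat) := {ffun {ffun 'I_M -> A} -> {set A}}.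

Definition add_set (S T : {set A}) : {set A} := [set s + t | s in S, t in T].
Definition app1 (zeta : operator1) (S : {set A}) : {set A} :=
  \bigcup_(s in S) zeta s.
Definition app2 (phi : operator2) (S T : {set A}) : {set A} :=
  \bigcup_(s in S) \bigcup_(t in T) phi s t.

Inductive term (n : nat) : Type :=
  | Unknown
  | Param of 'I_n
  | App of operator2 & term n & term n.

Arguments Unknown {n}.
Arguments Param {n} j.
Arguments App {n} phi t t'.

Fixpoint eval (n : nat) (y : A) (h : {ffun 'I_n -> A}) (t : term n) : {set A} :=
  match t with
  | Unknown => [set y]
  | Param j => [set h j]
  | App phi t t' => app2 phi (eval y h t) (eval y h t')
  end.

Definition satisfied (n : nat) (t1 t2 : term n)
    (y : A) (h : {ffun 'I_n -> A}) : bool :=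
  [exists v, (v \in eval y h t1) && (v \in eval y h t2)].

Definition solution (n : nat) (t1 t2 : term n) : operator n :=
  [ffun h => [set y | satisfied t1 t2 y h]].

Inductive superposition (n : nat) : operator n -> Prop :=
  | SupVar (eta : operator1) (j : 'I_n) :
      superposition [ffun h : {ffun 'I_n -> A} => eta (h j)]
  | SupAdd (F G : operator n) :
      superposition F -> superposition G ->
      superposition [ffun h => add_set (F h) (G h)]
  | SupComp (zeta : operator1) (F : operator n) :
      superposition F -> superposition [ffun h => app1 zeta (F h)].

(* Main.v *)
Require Import Defs.
From mathcomp Require Import all_boot all_order all_algebra.

(** Every operator [W : A^n -> P(A)] with [n >= 1] is a superposition, whatever
    equation it solves. Writing truth values as [o] and [e], a conjunction is
    a sum followed by an operator of one variable, because [e + e] differs from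
    both [o + o] and [o + e]; hence the indicator of each point [a] of [A^n] is
    a superposition, and so is the operator [W_a] with value [W a] at [a] and
    [{o}] elsewhere. As [{o}] is neutral for the addition of sets (also with
    the empty set), [W] is the sum of the [W_a]. *)

Import GRing.Theory.
Local Open Scope ring_scope.

Lemma add_set0l (S : {set A}) : add_set [set 0] S = S.
Proof.
apply/setP => x; apply/imset2P/idP => [[s t /set1P-> tS ->]|xS].
  by rewrite add0r.
by exists 0 x; rewrite ?set11 ?add0r.
Qed.

Lemma add_set0r (S : {set A}) : add_set S [set 0] = S.
Proof.
apply/setP => x; apply/imset2P/idP => [[s t sS /set1P-> ->]|xS].
  by rewrite addr0.
by exists x 0; rewrite ?set11 ?addr0.
Qed.

Lemma add_set1 (s t : A) : add_set [set s] [set t] = [set s + t].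
Proof. by rewrite /add_set imset2_set1l imset_set1. Qed.

Lemma app1_set1 (zeta : operator1) (s : A) : app1 zeta [set s] = zeta s.
Proof. exact: big_set1. Qed.

Lemma fun_e_three : fun_e \in three_functions.
Proof. by rewrite !inE eqxx !orbT. Qed.

Definition truth (b : bool) : A := if b then ThreeFun fun_e_three else 0.

Lemma truth_eq1 (b : bool) : (truth b == truth true) = b.
Proof.
case: b; first by rewrite eqxx.
(* Evaluation at [1] separates [o] from [e]: the values there are [0] and [1]. *)
by apply/eqP => /(congr1 (fun f : A => tf_val f 1)); rewrite !ffunE.
Qed.

Lemma truth_add (b c : bool) :
  (truth b + truth c == truth true + truth true) = b && c.
Proof.
case: b c => [] []; rewrite ?eqxx //.
- by rewrite (inj_eq (addrI _)) truth_eq1.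
- by rewrite (inj_eq (addIr _)) truth_eq1.
by apply/eqP => /(congr1 (fun f : A => tf_val f 1)); rewrite !ffunE.
Qed.

Section Superposition.

Variable n : nat.
Hypothesis hn : (1 <= n)%N.

Implicit Types (F G : operator n) (h a : {ffun 'I_n -> A}).

(** A constant operator of one variable is applied to the first parameter, which exists since
    [1 <= n]. *)
Lemma superposition_const (S : {set A}) :
  superposition ([ffun=> S] : operator n).
Proof. exact: (SupVar (fun=> S) (Ordinal hn)). Qed.

Lemma superposition_and (p q : pred {ffun 'I_n -> A}) :
  superposition ([ffun h => [set truth (p h)]] : operator n) ->
  superposition ([ffun h => [set truth (q h)]] : operator n) ->
  superposition ([ffun h => [set truth (p h && q h)]] : operator n).
Proof.
move=> supp supq.
have := SupComp (fun v => [set truth (v == truth true + truth true)])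
  (SupAdd supp supq).
by congr superposition; apply/ffunP => h;
  rewrite !ffunE add_set1 app1_set1 truth_add.
Qed.

Lemma superposition_point a :
  superposition ([ffun h => [set truth (h == a)]] : operator n).
Proof.
(* Equality with [a] is built up one coordinate at a time. *)
suff sup_all (s : seq 'I_n) : superposition
    ([ffun h : {ffun _ -> _} => [set truth (all (fun j => h j == a j) s)]] : operator n).
  have := sup_all (enum 'I_n); congr superposition; apply/ffunP => h.
  rewrite !ffunE; congr [set truth _]; apply/allP/eqP => [ha|-> //].
  by apply/ffunP => j; apply/eqP/ha; rewrite mem_enum.
elim: s => [|j s IHs] /=; first exact: superposition_const.
apply: superposition_and IHs.
exact: (SupVar (fun v => [set truth (v == a j)])).
Qed.

Theorem operator_superposition F : superposition F.
Proof.
(* The points of [s] are those whose [W_a] is already summed; [uniq] prevents adding [F a] twice at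
   [a], where [F a + F a] may differ from [F a]. *)
suff sup_on (s : seq {ffun 'I_n -> A}) : uniq s ->
    superposition ([ffun h => if h \in s then F h else [set 0]] : operator n).
  have := sup_on _ (enum_uniq {ffun 'I_n -> A}); congr superposition.
  by apply/ffunP => h; rewrite ffunE mem_enum.
elim: s => [_|a s IHs /= /andP[aNs /IHs sup_s]].
  exact: superposition_const.
(* The first summand is [W_a]. *)
have := SupAdd (SupComp (fun v => if v == truth true then F a else [set 0])
  (superposition_point a)) sup_s.
congr superposition; apply/ffunP => h.
rewrite !ffunE app1_set1 truth_eq1 inE; case: eqP => [->|_] /=.
  by rewrite (negPf aNs) add_set0r.
exact: add_set0l.
Qed.

End Superposition.

Theorem theorem7p3 (n : nat) (hn : (1 <= n)%N) (t1 t2 : term n) :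
  superposition (solution t1 t2).
Proof. exact: operator_superposition. Qed.
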